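(* Let $m\ge 1$ and $k\ge 0$ be integers, and let $\mathbf{P}_k(x)$ be an $\mathbb{R}_{0,m}$-valued homogeneous polynomial of degree $k$ on $\mathbb{R}^{m+1}$ which is monogenic in $\mathbb{R}^{m+1}$. Then there exists a shifted Appell sequence of monogenic polynomials $\{M_n(x)\}_{n\ge 0}$ such that $M_0(x)=\mathbf{P}_k(x)$; that is, there exist $\mathbb{R}_{0,m}$-valued polynomials $M_n(x)$, $n\ge 0$, on $\mathbb{R}^{m+1}$ with $\partial_x M_n=0$ in $\mathbb{R}^{m+1}$ for all $n\ge 0$, $\frac12\,\overline{\partial}_x M_n(x)=n\,M_{n-1}(x)$ for all $n\ge 1$, and $M_0(x)=\mathbf{P}_k(x)$.
   Context: $\mathbb{R}_{0,m}$ is the real Clifford algebra generated by the standard basis $e_1,\dots,e_m$ of $\mathbb{R}^m$ subject to $e_je_k+e_ke_j=-2\delta_{jk}$; it has real dimension $2^m$. Points of $\mathbb{R}^{m+1}$ are written $x=(x_0,x_1,\dots,x_m)$. The Dirac operator in $\mathbb{R}^m$ is $\partial_{\underline x}=\sum_{j=1}^m e_j\partial_{x_j}$ (acting from the left), the generalized Cauchy-Riemann operator in $\mathbb{R}^{m+1}$ is $\partial_x=\partial_{x_0}+\partial_{\underline x}$, and $\overline{\partial}_x=\partial_{x_0}-\partial_{\underline x}$. An $\mathbb{R}_{0,m}$-valued continuously differentiable function $f$ on an open set $\Omega\subset\mathbb{R}^{m+1}$ is (left) monogenic in $\Omega$ if $\partial_x f=0$ in $\Omega$. An $\mathbb{R}_{0,m}$-valued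 polynomial is a polynomial in the real coordinates with coefficients in $\mathbb{R}_{0,m}$. A shifted Appell sequence of monogenic polynomials is a sequence $\{M_n(x)\}_{n\ge0}$ of $\mathbb{R}_{0,m}$-valued polynomials, each monogenic in $\mathbb{R}^{m+1}$, such that $\frac12\,\overline{\partial}_xM_n(x)=nM_{n-1}(x)$ for all $n\ge1$ (the first term $M_0$ is an arbitrary monogenic polynomial, not necessarily constant). *)

(* Defs.v *)
From HB Require Import structures.
From mathcomp Require Import all_boot all_order all_algebra.
From mathcomp Require Import all_classical all_reals all_analysis.
From mathcomp Require Import ring.

Set Implicit Arguments.
Unset Strict Implicit.
Unset Printing Implicit Defensive.

Import Order.TTheory GRing.Theory Num.Theory.
Import numFieldNormedType.Exports.

Local Open Scope classical_set_scope.
Local Open Scope ring_scope.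

(* The Clifford algebra R_{0,m}.  Its 2^m basis blades e_A, A a subset of the
   index set 'I_m, are the products of the e_j, j in A, in increasing order of
   j (see [clifford_bladeE]); an element is the row vector of its coordinates
   in this basis, and inherits the normed space structure of row vectors.
   The generator written e_j with 1 <= j <= m on paper is [cgen] at j - 1. *)
Definition clifford (R : realType) (m : nat) : Type := 'rV[R]_#|{set 'I_m}|.

HB.instance Definition _ (R : realType) (m : nat) :=
  NormedModule.copy (clifford R m) 'rV[R]_#|{set 'I_m}|.

Section CliffordAlgebra.
Variables (R : realType) (m : nat).
Implicit Types (A B C D : {set 'I_m}) (x y z : clifford R m).

Definition ccoord x A : R := (x : 'rV[R]__) 0 (enum_rank A).

Definition cofun (F : {set 'I_m} -> R) : clifford R m :=
  \row_i F (enum_val i).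

Definition blade A : clifford R m := cofun (fun B => (B == A)%:R).

Definition cgen (j : 'I_m) : clifford R m := blade [set j].

Definition symdiff A B : {set 'I_m} := (A :\: B) :|: (B :\: A).

(* e_A e_B = csign A B * e_{A symdiff B}: one sign for each pair (i, j) in
   A x B with j < i (anticommutation) and one for each i = j (e_i^2 = -1). *)
Definition csign A B : R :=
  (-1) ^+ #|[set p in finset.setX A B | (p.2 <= p.1)%N]|.

Definition cmul x y : clifford R m :=
  cofun (fun C => \sum_A \sum_(B | symdiff A B == C)
                    csign A B * (ccoord x A * ccoord y B)).

Lemma cofunE F A : ccoord (cofun F) A = F A.
Proof. by rewrite /ccoord /cofun mxE enum_rankK. Qed.

Lemma clifford_eqP x y : (forall A, ccoord x A = ccoord y A) -> x = y.
Proof.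
move=> h; apply/matrixP => i j; rewrite (ord1 i).
by have := h (enum_val j); rewrite /ccoord enum_valK.
Qed.

Lemma ccoordD x y A : ccoord (x + y) A = ccoord x A + ccoord y A.
Proof. by rewrite /ccoord mxE. Qed.

Lemma ccoordN x A : ccoord (- x) A = - ccoord x A.
Proof. by rewrite /ccoord mxE. Qed.

Lemma ccoordZ (a : R) x A : ccoord (a *: x) A = a * ccoord x A.
Proof. by rewrite /ccoord mxE. Qed.

Lemma ccoord0 A : ccoord 0 A = 0.
Proof. by rewrite /ccoord mxE. Qed.

Lemma ccoord_blade A B : ccoord (blade A) B = (B == A)%:R.
Proof. exact: cofunE. Qed.

Lemma symdiffK A : cancel (symdiff A) (symdiff A).
Proof.
by move=> B; apply/setP => i; rewrite !inE; case: (i \in A); case: (i \in B).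
Qed.

Lemma symdiffA A B C : symdiff A (symdiff B C) = symdiff (symdiff A B) C.
Proof.
apply/setP => i; rewrite !inE.
by case: (i \in A); case: (i \in B); case: (i \in C).
Qed.

Lemma symdiffC A B : symdiff A B = symdiff B A.
Proof. by rewrite /symdiff finset.setUC. Qed.

Lemma symdiff0 A : symdiff finset.set0 A = A.
Proof. by apply/setP => i; rewrite !inE; case: (i \in A). Qed.

Lemma symdiffE A B C : (symdiff A B == C) = (B == symdiff A C).
Proof.
by apply/eqP/eqP => [<-|->]; rewrite symdiffK.
Qed.

Lemma csignE A B : csign A B =
  \prod_i \prod_j (if [&& i \in A, j \in B & (j <= i)%N] then -1 else 1).
Proof.
rewrite pair_big /= -big_mkcond /= prodr_const /csign; congr (_ ^+ _).
by apply: eq_card => -[i j]; rewrite !inE /= -?andbA.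
Qed.

Lemma csignDl A B C : csign (symdiff A B) C = csign A C * csign B C.
Proof.
rewrite !csignE -big_split /=; apply: eq_bigr => i _.
rewrite -big_split /=; apply: eq_bigr => j _; rewrite !inE.
case: (i \in A); case: (i \in B); case: (j \in C); case: (j <= i)%N;
  by rewrite /= ?mulrNN ?mulr1 ?mul1r.
Qed.

Lemma csignDr A B C : csign A (symdiff B C) = csign A B * csign A C.
Proof.
rewrite !csignE -big_split /=; apply: eq_bigr => i _.
rewrite -big_split /=; apply: eq_bigr => j _; rewrite !inE.
case: (i \in A); case: (j \in B); case: (j \in C); case: (j <= i)%N;
  by rewrite /= ?mulrNN ?mulr1 ?mul1r.
Qed.

Lemma ccoordM x y C : ccoord (cmul x y) C =
  \sum_A csign A (symdiff A C) * (ccoord x A * ccoord y (symdiff A C)).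
Proof.
rewrite cofunE; apply: eq_bigr => A _.
by rewrite (big_pred1 (symdiff A C)) // => B; rewrite /= symdiffE.
Qed.

Lemma cmulA : associative cmul.
Proof.
move=> x y z; apply: clifford_eqP => D; rewrite !ccoordM.
under eq_bigr => A _ do rewrite ccoordM mulr_sumr mulr_sumr.
under [RHS]eq_bigr => E _ do rewrite ccoordM mulr_suml mulr_sumr.
rewrite [RHS]exchange_big /=; apply: eq_bigr => A _.
rewrite [RHS](reindex_inj (can_inj (symdiffK A))) /=; apply: eq_bigr => B _.
rewrite symdiffK symdiffA (symdiffC B A); set F := symdiff (symdiff A B) D.
have -> : symdiff A D = symdiff B F.
  apply/setP => i; rewrite !inE.
  by case: (i \in A); case: (i \in B); case: (i \in D).
rewrite csignDl csignDr; ring.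
Qed.

Lemma symdiff_eq0 A B : (symdiff A B == finset.set0) = (A == B).
Proof.
rewrite symdiffE; apply/eqP/eqP => [->|<-]; apply/setP => i;
  by rewrite !inE; case: (i \in A).
Qed.

Lemma csign0l B : csign finset.set0 B = 1.
Proof. by rewrite csignE !big1 // => i _; rewrite big1 // => j _; rewrite inE. Qed.

Lemma csign0r A : csign A finset.set0 = 1.
Proof.
by rewrite csignE !big1 // => i _; rewrite big1 // => j _; rewrite inE andbF.
Qed.

Lemma cmul_blade A B : cmul (blade A) (blade B) = csign A B *: blade (symdiff A B).
Proof.
apply: clifford_eqP => C; rewrite ccoordM ccoordZ ccoord_blade.
rewrite (bigD1 A) //= big1 ?addr0 => [|A' neA]; last first.
  by rewrite ccoord_blade (negPf neA) mul0r mulr0.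
rewrite !ccoord_blade eqxx mul1r symdiffE (eq_sym C) symdiffE.
by rewrite (eq_sym B); case: eqP => [->|]; rewrite ?mulr0.
Qed.

Lemma cmul1l : left_id (blade finset.set0) cmul.
Proof.
move=> x; apply: clifford_eqP => C; rewrite ccoordM (bigD1 finset.set0) //=.
rewrite big1 ?addr0 => [|A neA]; last first.
  by rewrite ccoord_blade (negPf neA) mul0r mulr0.
by rewrite ccoord_blade eqxx csign0l symdiff0 !mul1r.
Qed.

Lemma cmul1r : right_id (blade finset.set0) cmul.
Proof.
move=> x; apply: clifford_eqP => C; rewrite ccoordM (bigD1 C) //=.
have e0 : symdiff C C = finset.set0 by apply/eqP; rewrite symdiff_eq0.
rewrite big1 ?addr0 => [|A neA]; last first.
  by rewrite ccoord_blade symdiff_eq0 (negPf neA) !mulr0.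
by rewrite e0 ccoord_blade eqxx csign0r mul1r mulr1.
Qed.

Lemma cmulDl : left_distributive cmul +%R.
Proof.
move=> x y z; apply: clifford_eqP => C; rewrite ccoordD !ccoordM -big_split /=.
by apply: eq_bigr => A _; rewrite ccoordD mulrDl mulrDr.
Qed.

Lemma cmulDr : right_distributive cmul +%R.
Proof.
move=> x y z; apply: clifford_eqP => C; rewrite ccoordD !ccoordM -big_split /=.
by apply: eq_bigr => A _; rewrite ccoordD mulrDr mulrDr.
Qed.

Lemma cone_neq0 : blade finset.set0 != 0.
Proof.
apply/eqP => /(congr1 (ccoord^~ finset.set0)).
by rewrite ccoord_blade ccoord0 eqxx => /eqP; rewrite oner_eq0.
Qed.

HB.instance Definition _ := GRing.Zmodule_isNzRing.Build (clifford R m)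
  cmulA cmul1l cmul1r cmulDl cmulDr cone_neq0.

Fact cscaleAl (a : R) x y : a *: (x * y) = (a *: x) * y.
Proof.
apply: clifford_eqP => C; rewrite ccoordZ !ccoordM mulr_sumr.
by apply: eq_bigr => A _; rewrite ccoordZ; ring.
Qed.

HB.instance Definition _ :=
  GRing.Lmodule_isLalgebra.Build R (clifford R m) cscaleAl.

Fact cscaleAr (a : R) x y : a *: (x * y) = x * (a *: y).
Proof.
apply: clifford_eqP => C; rewrite ccoordZ !ccoordM mulr_sumr.
by apply: eq_bigr => A _; rewrite ccoordZ; ring.
Qed.

HB.instance Definition _ :=
  GRing.Lalgebra_isAlgebra.Build R (clifford R m) cscaleAr.

Lemma bladeM A B : blade A * blade B = csign A B *: blade (symdiff A B).
Proof. exact: cmul_blade. Qed.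

Lemma csign1 (i j : 'I_m) : csign [set i] [set j] = if (j <= i)%N then -1 else 1.
Proof.
rewrite csignE (bigD1 i) //= (bigD1 j) //= !inE !eqxx /=.
rewrite big1 ?mulr1 => [|k nk]; last by rewrite !inE (negPf nk).
rewrite big1 ?mulr1 // => k nk; rewrite big1 // => l _.
by rewrite inE (negPf nk).
Qed.

Lemma cgen_clifford (j k : 'I_m) :
  cgen j * cgen k + cgen k * cgen j = (- (2 * (j == k)%:R)) *: 1.
Proof.
rewrite !bladeM (symdiffC [set k]) -scalerDl !csign1.
have [->|neq] := eqVneq j k.
  have /eqP -> : symdiff [set k] [set k] == finset.set0 by rewrite symdiff_eq0.
  by rewrite leqnn; congr (_ *: _); rewrite /= mulr1; ring.
have : (j : nat) != k by [].
rewrite neq_ltn => /orP[] lt; rewrite (ltnW lt) leqNgt lt /=;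
  by rewrite ?subrr ?addNr ?mulr0 ?oppr0 !scale0r.
Qed.

Lemma clifford_bladeE A : blade A = \prod_(j <- enum 'I_m | j \in A) cgen j.
Proof.
suff H n : (n <= m)%N -> \prod_(j <- take n (enum 'I_m) | j \in A) cgen j
           = blade [set j in A | (j < n)%N].
  have := H m (leqnn m); rewrite take_oversize ?size_enum_ord // => ->.
  by congr blade; apply/setP => j; rewrite inE ltn_ord andbT.
elim: n => [_|n IH ltnm].
  by rewrite take0 big_nil; congr blade; apply/setP => j; rewrite !inE andbF.
pose o := Ordinal ltnm.
have -> : take n.+1 (enum 'I_m) = rcons (take n (enum 'I_m)) o.
  by rewrite (take_nth o) ?size_enum_ord // (nth_ord_enum o o).
rewrite big_rcons IH ?(ltnW ltnm) //; case: ifPn => oA; last first.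
  rewrite [LHS]mulr1; congr blade; apply/setP => j; rewrite !inE ltnS.
  case jA: (j \in A) => //=; rewrite [RHS]leq_eqVlt.
  by case: eqVneq => //= e; case/negP: oA; rewrite -(_ : j = o) //; apply/val_inj.
rewrite [LHS]bladeM (_ : csign _ _ = 1) ?scale1r.
  congr blade; apply/setP => j; rewrite !inE ltnS.
  case: (eqVneq j o) => [->|neq]; first by rewrite oA ltnn leqnn.
  by rewrite /= andbF orbF; congr (_ && _); rewrite ltn_neqAle (_ : (j : nat) != n).
rewrite csignE big1 // => i _; rewrite big1 // => j _; rewrite !inE.
by case: ifP => // /and3P[/andP[_ lt] /eqP ->] /=; rewrite leqNgt lt.
Qed.


End CliffordAlgebra.

Section Monogenic.
Variables (R : realType) (m : nat).
Local Notation point := 'rV[R]_m.+1.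
Local Notation Cl := (clifford R m).
Implicit Types (f : point -> Cl) (x : point) (Omega : set point).

(* A point (x_0, x_1, ..., x_m) has coordinates [x 0 i], i : 'I_m.+1, and the
   coordinate x_j going with the generator [cgen j] is [x 0 (lift ord0 j)]. *)
Definition partial (i : 'I_m.+1) f : point -> Cl :=
  'D_(delta_mx 0 i : point) f.

Definition dirac f : point -> Cl :=
  fun x => \sum_(j < m) cgen R j * partial (lift ord0 j) f x.

Definition cauchy_riemann f : point -> Cl :=
  fun x => partial ord0 f x + dirac f x.

Definition conj_cauchy_riemann f : point -> Cl :=
  fun x => partial ord0 f x - dirac f x.

(* Meant for open sets Omega. *)
Definition continuously_differentiable Omega f : Prop :=
  forall (i : 'I_m.+1) x, Omega x ->
    derivable f x (delta_mx 0 i : point) /\ {for x, continuous (partial i f)}.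

Definition monogenic Omega f : Prop :=
  continuously_differentiable Omega f /\
  forall x, Omega x -> cauchy_riemann f x = 0.

Definition monomial d (a : {ffun 'I_m.+1 -> 'I_d}) x : R :=
  \prod_(i < m.+1) x 0 i ^+ a i.

Definition clifford_polynomial f : Prop :=
  exists (d : nat) (c : {ffun 'I_m.+1 -> 'I_d} -> Cl),
    forall x, f x = \sum_a monomial a x *: c a.

(* The zero polynomial is homogeneous of every degree. *)
Definition homogeneous_polynomial (k : nat) f : Prop :=
  exists c : {ffun 'I_m.+1 -> 'I_k.+1} -> Cl,
    forall x, f x =
      \sum_(a : {ffun 'I_m.+1 -> 'I_k.+1} | (\sum_(i < m.+1) a i == k)%N)
         monomial a x *: c a.

Definition shifted_appell (M : nat -> point -> Cl) : Prop :=
  (forall n, clifford_polynomial (M n) /\ monogenic setT (M n)) /\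
  (forall n, (1 <= n)%N ->
    forall x, 2^-1 *: conj_cauchy_riemann (M n) x = n%:R *: M n.-1 x).

End Monogenic.

(* Main.v *)
(* It suffices to find, for a monogenic polynomial f, a polynomial g with
   d_0 g = f and D g = -f, where D is the Dirac operator: then g is monogenic
   and (d_0 - D) g = 2 f.  Start from any polynomial antiderivative G of f in
   x_0.  Since f is monogenic, r = D G + f satisfies d_0 r = 0, so r does not
   depend on x_0, and it remains to solve D q = r with q independent of x_0.
   This is where m >= 1 enters: inverting e_1 d_1 by integration in x_1, the
   remaining part of D lowers the degree in x_2, ..., x_m. *)
Require Import Defs.
From mathcomp Require Import all_boot all_order all_algebra.
From mathcomp Require Import all_classical all_reals all_analysis.

Set Implicit Arguments.
Unset Strict Implicit.
Unset Printing Implicit Defensive.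

Import Order.TTheory GRing.Theory Num.Theory.
Import numFieldNormedType.Exports.

Local Open Scope classical_set_scope.
Local Open Scope ring_scope.

(** * Directional derivatives of maps between normed spaces *)

Section DirectionalDerivative.
Variables (R : realType) (V W : normedModType R).
Implicit Types (x v : V).

Lemma is_derive_line_cst (f : V -> W) x v :
  (forall h : R, f (h *: v + x) = f x) -> is_derive x v f 0.
Proof.
move=> fx.
have E : (fun h : R => h^-1 *: ((f \o shift x) (h *: v) - f x)) = cst 0.
  by apply/funext => h; rewrite /= fx subrr scaler0.
split; first by rewrite /derivable E; apply: is_cvg_cst.
by rewrite /derive E; apply/cvg_lim => //; apply: cvg_cst.
Qed.

Lemma is_derive_scaler (f : V -> R) (c : W) x v df :
  is_derive x v f df -> is_derive x v (fun y => f y *: c) (df *: c).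
Proof.
move=> [fd fv].
have H : (h^-1 *: (((fun y => f y *: c) \o shift x) (h *: v) - f x *: c))
    @[h --> (0 : R)^'] --> df *: c.
  have -> : (fun h : R => h^-1 *: (((fun y => f y *: c) \o shift x) (h *: v)
      - f x *: c)) = fun h : R => (h^-1 *: ((f \o shift x) (h *: v) - f x)) *: c.
    by apply/funext => h /=; rewrite -scalerBl scalerA.
  by apply: cvgZr_tmp; rewrite -fv.
by split; [apply/cvg_ex; exists (df *: c) | apply/cvg_lim].
Qed.

(** Turns a derivative along [v] into a derivative in one real variable, where the constancy theorem
    for functions with zero derivative applies. *)
Lemma is_derive_line (f : V -> W) x v (t : R) df :
  is_derive (t *: v + x) v f df ->
  is_derive t 1 (fun s : R => f (s *: v + x)) df.
Proof.
have E : (fun h : R => h^-1 *: (((fun s : R => f (s *: v + x)) \o shift t)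
    (h *: 1) - f (t *: v + x))) =
    (fun h : R => h^-1 *: ((f \o shift (t *: v + x)) (h *: v) - f (t *: v + x))).
  by apply/funext => h; rewrite /= scalerDl addrA [h *: 1]mulr1.
by move=> [fd fv]; split; [rewrite /derivable E | rewrite -fv /derive E].
Qed.

End DirectionalDerivative.

(** * Monomials with unbounded exponents *)

Section PolynomialMaps.
Variables (R : realType) (m : nat).
Local Notation point := 'rV[R]_m.+1.
Local Notation Cl := (clifford R m).
Local Notation dirac := Defs.dirac.
Local Notation exponent := ('I_m.+1 -> nat).
Implicit Types (f g : point -> Cl) (x : point) (a : exponent) (c : Cl).
Implicit Types (i j : 'I_m.+1).

(* [monomial] with exponents that carry no bound. *)
Definition mono a x : R := \prod_(i < m.+1) x 0 i ^+ a i.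

Definition incr i a : exponent := fun j => (a j + (j == i))%N.
(* The truncation at [a i = 0] is harmless: [decr i a] always comes with the
   factor [a i]. *)
Definition decr i a : exponent := fun j => (a j - (j == i))%N.

Lemma incrK i : cancel (incr i) (decr i).
Proof. by move=> a; apply/funext => j; rewrite /incr /decr addnK. Qed.

Lemma is_derive_coord x i j :
  is_derive x (delta_mx 0 i) (fun y : point => y 0 j : R) (j == i)%:R.
Proof.
have H : (h^-1 *: (((fun y : point => y 0 j : R) \o shift x)
    (h *: delta_mx 0 i) - x 0 j)) @[h --> (0 : R)^'] --> ((j == i)%:R : R).
  apply: cvg_near_cst; near=> h.
  rewrite /= !mxE eqxx /= addrK [_ *: _]mulKf //.
  by near: h; apply: nbhs_dnbhs_neq.
by split; [apply/cvg_ex; exists (j == i)%:R | apply/cvg_lim].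
Unshelve. all: by end_near. Qed.

Lemma is_derive_mono a x i :
  is_derive x (delta_mx 0 i) (mono a) ((a i)%:R * mono (decr i a) x).
Proof.
(* Split off the power of [x_i]; the remaining product [g] is constant along the direction [i]. *)
pose p (y : point) := y 0 i : R.
pose g (y : point) := \prod_(j < m.+1 | j != i) y 0 j ^+ a j : R.
have -> : mono a = p ^+ a i * g.
  by apply/funext => y; rewrite /mono (bigD1 i) //= fctE exprfctE.
have dg : is_derive x (delta_mx 0 i) g 0.
  apply: is_derive_line_cst => h; apply: eq_bigr => j ji.
  by rewrite !mxE (negPf ji) andbF mulr0 add0r.
have dp : is_derive x (delta_mx 0 i) p 1.
  by have := is_derive_coord x i i; rewrite eqxx.
apply: is_derive_eq.
rewrite scaler0 add0r /GRing.scale /= mulr1 mulrC -mulrA; congr (_ * _).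
rewrite /mono (bigD1 i) //= /decr eqxx subn1; congr (_ * _).
by apply: eq_bigr => j ji; rewrite (negPf ji) subn0.
Qed.

Lemma continuous_mono a : continuous (mono a : point -> R).
Proof.
suff H r : continuous (fun x : point => \prod_(i <- r) x 0 i ^+ a i : R).
  exact: H.
elim: r => [|i r IH] x.
  under eq_fun do rewrite big_nil.
  exact: (@cst_continuous point R).
under eq_fun do rewrite big_cons.
apply: (@cvgM _ _ (nbhs (x : point)) _); last exact: IH.
have ci : {for x, continuous (fun y : point => y 0 i : R)}.
  exact: coord_continuous.
exact: (continuous_comp ci (@exprn_continuous R (a i) (x 0 i))).
Qed.

(** * Clifford-valued polynomial maps and their partial derivatives *)

Definition term a c : point -> Cl := fun x => mono a x *: c.

(** Polynomials as finite sums of terms, with no bound on the degree: an additive property need only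
    be checked on terms. *)
Inductive poly_map : (point -> Cl) -> Prop :=
| poly_map0 : poly_map 0
| poly_map_term a c : poly_map (term a c)
| poly_mapD f g : poly_map f -> poly_map g -> poly_map (f + g).

Lemma is_derive_term a c x i :
  is_derive x (delta_mx 0 i) (term a c) (term (decr i a) ((a i)%:R *: c) x).
Proof.
rewrite /term scalerA mulrC.
exact: is_derive_scaler (is_derive_mono _ _ _).
Qed.

Lemma partial_term a c i :
  partial i (term a c) = term (decr i a) ((a i)%:R *: c).
Proof. by apply/funext => x; have [_] := is_derive_term a c x i. Qed.

Lemma partial0 i : partial i (0 : point -> Cl) = 0.
Proof.
apply/funext => x.
by have [_] := @is_derive_line_cst R _ Cl 0 x (delta_mx 0 i) (fun=> erefl).
Qed.

Lemma poly_map_derivable f x i : poly_map f -> derivable f x (delta_mx 0 i).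
Proof.
elim=> [|a c|g h _ dg _ dh].
- by have [] := @is_derive_line_cst R _ Cl 0 x (delta_mx 0 i) (fun=> erefl).
- by have [] := is_derive_term a c x i.
- exact: derivableD.
Qed.

Lemma partialD f g i : poly_map f -> poly_map g ->
  partial i (f + g) = partial i f + partial i g.
Proof.
by move=> pf pg; apply/funext => x; apply: deriveD; apply: poly_map_derivable.
Qed.

Lemma poly_map_partial f i : poly_map f -> poly_map (partial i f).
Proof.
elim=> [|a c|g h pg dg ph dh]; first by rewrite partial0; constructor.
  by rewrite partial_term; constructor.
by rewrite partialD //; constructor.
Qed.

Lemma poly_map_continuous f : poly_map f -> continuous f.
Proof.
elim=> [|a c|g h _ cg _ ch] x; first exact: cst_continuous.
  apply: (@cvgZr_tmp _ _ _ (nbhs (x : point)) _); exact: continuous_mono.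
by apply: (@cvgD _ _ _ (nbhs (x : point)) _); [apply: cg | apply: ch].
Qed.

Lemma poly_map_C1 f : poly_map f -> continuously_differentiable setT f.
Proof.
move=> pf i x _; split; first exact: poly_map_derivable.
exact/poly_map_continuous/poly_map_partial.
Qed.

Lemma poly_map_lmul u f : poly_map f -> poly_map (fun x => u * f x).
Proof.
elim=> [|a c|g h _ pg _ ph].
- rewrite (_ : (fun _ => _) = 0); first by constructor.
  by apply/funext => x; rewrite mulr0.
- rewrite (_ : (fun _ => _) = term a (u * c)); first by constructor.
  by apply/funext => x; rewrite /term scalerAr.
- rewrite (_ : (fun _ => _) = (fun x => u * g x) + (fun x => u * h x)).
    by constructor.
  by apply/funext => x; rewrite -mulrDr.
Qed.

Lemma partial_lmul u f i : poly_map f ->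
  partial i (fun x => u * f x) = fun x => u * partial i f x.
Proof.
elim=> [|a c|g h pg dg ph dh].
- rewrite (_ : (fun _ => _) = 0); last by apply/funext => x; rewrite mulr0.
  by rewrite partial0; apply/funext => x; rewrite mulr0.
- rewrite (_ : (fun _ => _) = term a (u * c)); last first.
    by apply/funext => x; rewrite /term scalerAr.
  by rewrite !partial_term; apply/funext => x; rewrite /term !scalerAr.
- rewrite (_ : (fun _ => _) = (fun x => u * g x) + (fun x => u * h x)); last first.
    by apply/funext => x; rewrite -mulrDr.
  rewrite (partialD _ pg ph) partialD; do ?[exact: poly_map_lmul].
  by rewrite dg dh; apply/funext => x; rewrite [RHS]mulrDr.
Qed.

(** On a term this is an identity between exponents and coefficients, so Schwarz's theorem is
    avoided. *)
Lemma partialC f i j : poly_map f ->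
  partial i (partial j f) = partial j (partial i f).
Proof.
elim=> [|a c|g h pg dg ph dh]; first by rewrite !partial0.
  rewrite !partial_term; have [->//|ij] := eqVneq i j.
  have -> : decr i (decr j a) = decr j (decr i a).
    by apply/funext => l; rewrite /decr subnAC.
  congr term; rewrite !scalerA mulrC.
  by rewrite /decr (negPf ij) eq_sym (negPf ij) !subn0.
rewrite (partialD j pg ph) (partialD i pg ph).
have pp l : poly_map (partial l g) /\ poly_map (partial l h).
  by split; apply: poly_map_partial.
have [[pgi phi] [pgj phj]] := (pp i, pp j).
by rewrite (partialD i pgj phj) (partialD j pgi phi) dg dh.
Qed.

Lemma poly_map_sum (I : finType) (F : I -> point -> Cl) (Q : pred I) :
  (forall l, Q l -> poly_map (F l)) -> poly_map (\sum_(l | Q l) F l).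
Proof. by move=> pF; elim/big_ind: _ => //; constructor. Qed.

Lemma partial_sum n (F : 'I_n -> point -> Cl) i :
  (forall l, poly_map (F l)) ->
  partial i (\sum_(j < n) F j) = \sum_(j < n) partial i (F j).
Proof.
move=> pF; elim: n F pF => [|n IH] F pF; first by rewrite !big_ord0 partial0.
rewrite !big_ord_recr /= partialD; [|exact: poly_map_sum|exact: pF].
by rewrite IH.
Qed.

(** * The Dirac operator on polynomial maps *)

Lemma diracE f :
  dirac f = \sum_(j < m) (fun x => cgen R j * partial (lift ord0 j) f x).
Proof. by apply/funext => x; rewrite fct_sumE. Qed.

Lemma poly_map_dirac f : poly_map f -> poly_map (dirac f).
Proof.
move=> pf; rewrite diracE; apply: poly_map_sum => j _.
exact/poly_map_lmul/poly_map_partial.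
Qed.

Lemma diracD f g : poly_map f -> poly_map g ->
  dirac (f + g) = dirac f + dirac g.
Proof.
move=> pf pg; rewrite !diracE -big_split /=; apply: eq_bigr => j _.
by rewrite partialD //; apply/funext => x; rewrite [LHS]mulrDr.
Qed.

Lemma partial_dirac f i : poly_map f ->
  partial i (dirac f) = dirac (partial i f).
Proof.
move=> pf; rewrite !diracE partial_sum => [|j]; last first.
  exact/poly_map_lmul/poly_map_partial.
apply: eq_bigr => j _.
rewrite partial_lmul; last exact: poly_map_partial.
by rewrite (partialC _ _ pf).
Qed.

Lemma lmulN1 f : (fun x => -1 * f x) = - f.
Proof. by apply/funext => x; rewrite mulN1r. Qed.

Lemma poly_mapN f : poly_map f -> poly_map (- f).
Proof. by move=> pf; rewrite -lmulN1; apply: poly_map_lmul. Qed.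

Lemma partialN f i : poly_map f -> partial i (- f) = - partial i f.
Proof. by move=> pf; rewrite -(lmulN1 f) partial_lmul ?lmulN1. Qed.

Lemma diracN f : poly_map f -> dirac (- f) = - dirac f.
Proof.
move=> pf; rewrite !diracE -sumrN; apply: eq_bigr => j _.
by rewrite partialN //; apply/funext => x; rewrite [LHS]mulrN.
Qed.

(** * Antiderivatives in one variable, and maps that do not depend on a variable *)

Lemma poly_map_antiderivative f i : poly_map f ->
  exists2 g, poly_map g & partial i g = f.
Proof.
elim=> [|a c|f1 f2 _ [g1 p1 <-] _ [g2 p2 <-]].
- by exists 0; [constructor | rewrite partial0].
- exists (term (incr i a) ((a i).+1%:R^-1 *: c)); first by constructor.
  rewrite partial_term incrK scalerA /incr eqxx addn1 divff ?scale1r //.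
- by exists (g1 + g2); [constructor | rewrite partialD].
Qed.

(** A coordinate is linear and continuous, so it passes through the limit of the difference
    quotients. *)
Lemma is_derive_ccoord (V : normedModType R) (f : V -> Cl) (x v : V) df A :
  is_derive x v f df ->
  is_derive x v (fun y => ccoord (f y) A) (ccoord df A).
Proof.
move=> [fd fv].
have H : (h^-1 *: (((fun y => ccoord (f y) A) \o shift x) (h *: v)
    - ccoord (f x) A)) @[h --> (0 : R)^'] --> ccoord df A.
  have -> : (fun h : R => h^-1 *: (((fun y => ccoord (f y) A) \o shift x) (h *: v)
      - ccoord (f x) A)) =
      (fun u : Cl => ccoord u A) \o
      (fun h : R => h^-1 *: ((f \o shift x) (h *: v) - f x)).
    by apply/funext => h /=; rewrite ccoordZ ccoordD ccoordN.
  apply: cvg_comp; first exact: fd.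
  rewrite -/(derive f x v) fv; exact: coord_continuous.
by split; [apply/cvg_ex; exists (ccoord df A) | apply/cvg_lim].
Qed.

(** Along the line, each coordinate is a real function of one variable with zero derivative. *)
Lemma partial_eq0_cst f i x (h : R) : poly_map f -> partial i f = 0 ->
  f (h *: delta_mx 0 i + x) = f x.
Proof.
move=> pf f0; apply: clifford_eqP => A.
pose phi (t : R) := ccoord (f (t *: delta_mx 0 i + x)) A.
have d (t : R) : is_derive t (1 : R) phi 0.
  rewrite -(ccoord0 R A); apply: is_derive_ccoord; apply: is_derive_line.
  split; first exact: poly_map_derivable.
  by have := congr1 (fun g => g (t *: delta_mx 0 i + x)) f0.
by have := is_derive_0_is_cst h 0 d; rewrite /phi scale0r add0r.
Qed.

(** The projection onto the hyperplane [x_0 = 0], written as a translation along the axis of [x_0]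
    to match [partial_eq0_cst]. *)
Definition proj0 x : point := - x 0 ord0 *: delta_mx 0 ord0 + x.

Lemma mono_proj0 a x :
  mono a (proj0 x) = if a ord0 == 0%N then mono a x else 0.
Proof.
rewrite /mono (bigD1 ord0) //= !mxE !eqxx mulr1 addNr expr0n.
case: eqP => [a0|]; last by rewrite mul0r.
rewrite mul1r [RHS](bigD1 ord0) //= a0 mul1r; apply: eq_bigr => j j0.
by rewrite !mxE (negPf j0) andbF mulr0 add0r.
Qed.

(** * Solving [D q = f] with [q] independent of [x_0] *)

Lemma dirac0 : dirac (0 : point -> Cl) = 0.
Proof.
rewrite diracE big1 // => j _; rewrite partial0.
by apply/funext => x; rewrite mulr0.
Qed.

(** Requiring [partial ord0 q = 0] allows [q] to be subtracted later without changing a derivative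
    in [x_0]. *)
Definition in_dirac_image f :=
  exists q, [/\ poly_map q, partial ord0 q = 0 & dirac q = f].

Lemma in_dirac_image0 : in_dirac_image 0.
Proof. by exists 0; split; [constructor | exact: partial0 | exact: dirac0]. Qed.

Lemma in_dirac_imageD f g :
  in_dirac_image f -> in_dirac_image g -> in_dirac_image (f + g).
Proof.
move=> [p [pp p0 <-]] [q [pq q0 <-]]; exists (p + q); split.
- by constructor.
- by rewrite (partialD _ pp pq) p0 q0 addr0.
- exact: diracD.
Qed.

Lemma in_dirac_imageN f : in_dirac_image f -> in_dirac_image (- f).
Proof.
move=> [p [pp p0 <-]]; exists (- p); split.
- exact: poly_mapN.
- by rewrite (partialN _ pp) p0 oppr0.
- exact: diracN.
Qed.

Lemma term0 a : term a 0 = 0.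
Proof. by apply/funext => x; rewrite /term scaler0. Qed.

Lemma cgen_sqr (j : 'I_m) : cgen R j * cgen R j = -1.
Proof.
rewrite bladeM csign1 leqnn scaleN1r.
by have /eqP -> : symdiff [set j]%SET [set j]%SET == finset.set0
  by rewrite symdiff_eq0.
Qed.

Lemma dirac_term a c :
  dirac (term a c) = \sum_(j < m) term (decr (lift ord0 j) a)
    (cgen R j * ((a (lift ord0 j))%:R *: c)).
Proof.
rewrite diracE; apply: eq_bigr => j _; rewrite partial_term.
by apply/funext => x; rewrite /term -scalerAr.
Qed.

(* In the direction [o] the operator [cgen o * partial o] is inverted by
   integration; what the other directions leave has a lower degree in the
   other variables. *)
Lemma in_dirac_image_term (o : 'I_m) a c :
  a ord0 = 0%N -> in_dirac_image (term a c).
Proof.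
(* Induction on the total degree in the variables other than [x_0] and the one going with [o]. *)
have [N] := ubnP (\sum_(j < m | j != o) a (lift ord0 j)).
elim: N a c => // N IH a c degN a0.
set i := lift ord0 o; pose b := incr i a.
(* The inverse integer cancels the factor from differentiating [b], and the sign compensates
   [cgen o] squared being -1; hence the [o] summand of [dirac (term b d)] is [term a c]. *)
pose d : Cl := - ((a i).+1%:R^-1 *: (cgen R o * c)).
have bi : b i = (a i).+1 by rewrite /b /incr eqxx addn1.
have bE l : l != i -> b l = a l by move=> li; rewrite /b /incr (negPf li) addn0.
have b0 : b ord0 = 0%N by rewrite bE.
pose r := \sum_(j < m | j != o) term (decr (lift ord0 j) b)
    (cgen R j * ((b (lift ord0 j))%:R *: d)).
have -> : term a c = dirac (term b d) + - r.
  rewrite dirac_term (bigD1 o) //= addrK -/i incrK bi; congr term.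
  rewrite scalerN scalerA divff ?scale1r ?mulrN ?mulrA ?cgen_sqr.
    by rewrite mulN1r opprK.
  by rewrite pnatr_eq0.
apply: in_dirac_imageD.
  exists (term b d); split=> //; first by constructor.
  by rewrite partial_term b0 scale0r term0.
apply: in_dirac_imageN; rewrite /r.
elim/big_ind: _ => [||j jo]; [exact: in_dirac_image0|exact: in_dirac_imageD|].
have ji : lift ord0 j != i by rewrite (inj_eq (@lift_inj _ _)).
rewrite (bE _ ji).
(* With exponent 0 the coefficient vanishes; otherwise differentiating in direction [j] lowers the
   induction degree by one. *)
case aj : (a (lift ord0 j)) => [|n].
  by rewrite scale0r mulr0 term0; exact: in_dirac_image0.
apply: IH; last by rewrite /decr b0.
move: degN; rewrite ltnS; apply: leq_trans.
rewrite [in X in (_ <= X)%N](bigD1 j) //= (bigD1 j) //= aj.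
rewrite {1}/decr (bE _ ji) aj eqxx subn1 /= ltnS leq_add2l.
apply: leq_sum => l /andP[lo lj].
by rewrite /decr bE ?leq_subr // (inj_eq (@lift_inj _ _)).
Qed.

(** A map independent of [x_0] may still be presented by terms containing [x_0] that cancel.
    Composing with [proj0] kills those terms and keeps the others. *)
Lemma in_dirac_image_proj0 f : (0 < m)%N -> poly_map f ->
  in_dirac_image (f \o proj0).
Proof.
move=> m0; elim=> [|a c|g h _ sg _ sh].
- exact: in_dirac_image0.
- have [a0|a0] := eqVneq (a ord0) 0%N.
    rewrite (_ : _ \o _ = term a c); last first.
      by apply/funext => x; rewrite /term /= mono_proj0 a0.
    exact: (in_dirac_image_term (Ordinal m0)).
  rewrite (_ : _ \o _ = 0); first exact: in_dirac_image0.
  by apply/funext => x; rewrite /term /= mono_proj0 (negPf a0) scale0r.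
- exact: in_dirac_imageD.
Qed.

(** * Monogenic antiderivatives *)

Lemma monogenic_antiderivative f : (0 < m)%N -> poly_map f ->
  partial ord0 f + dirac f = 0 ->
  exists g, [/\ poly_map g, partial ord0 g = f & dirac g = - f].
Proof.
move=> m0 pf mf; have [g pg gf] := poly_map_antiderivative ord0 pf.
pose r := dirac g + f.
have pDg := poly_map_dirac pg.
have pr : poly_map r by constructor.
have r0 : partial ord0 r = 0.
  (* Since [D] commutes with the derivative in [x_0], that of [r] is [D f] plus that of [f]. *)
  by rewrite (partialD _ pDg pf) (partial_dirac _ pg) gf addrC.
have [q [pq q0 qr]] := in_dirac_image_proj0 m0 pr.
have rE : r \o proj0 = r.
  by apply/funext => x; rewrite /= /proj0 partial_eq0_cst.
(* The correction gives [D (g - q) = D g - (D g + f) = - f]. *)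
exists (g + - q); have pNq := poly_mapN pq; split; first by constructor.
- by rewrite (partialD _ pg pNq) (partialN _ pq) q0 oppr0 addr0.
- by rewrite (diracD pg pNq) (diracN pq) qr rE /r opprD addNKr.
Qed.

(** * Passage to and from polynomials with bounded exponents *)

Lemma poly_map_polynomial f : poly_map f -> clifford_polynomial f.
Proof.
(* Allowing every large enough bound [d] lets two summands share one. *)
suff H : poly_map f -> exists N, forall d, (N <= d)%N ->
    exists c : {ffun 'I_m.+1 -> 'I_d.+1} -> Cl,
      forall x, f x = \sum_b monomial b x *: c b.
  by move=> /H[N /(_ N (leqnn N)) fN]; exists N.+1.
elim=> [|a c|g h _ [Ng gN] _ [Nh hN]].
- exists 0%N => d _; exists (fun=> 0) => x.
  by rewrite big1 // => b _; rewrite scaler0.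
- exists (\sum_i a i)%N => d ad.
  pose b0 := [ffun i => inord (a i)] : {ffun 'I_m.+1 -> 'I_d.+1}.
  have b0E i : b0 i = a i :> nat.
    by rewrite ffunE inordK // ltnS (leq_trans _ ad) // (bigD1 i) //= leq_addr.
  exists (fun b => if b == b0 then c else 0) => x.
  rewrite (bigD1 b0) //= eqxx big1 => [|b /negPf->]; last by rewrite scaler0.
  rewrite addr0; congr (_ *: _); apply: eq_bigr => i _; by rewrite b0E.
- exists (maxn Ng Nh) => d; rewrite geq_max => /andP[/gN[c gE] /hN[e hE]].
  exists (fun b => c b + e b) => x.
  rewrite [LHS](congr2 _ (gE x) (hE x)) -big_split /=.
  by apply: eq_bigr => b _; rewrite scalerDr.
Qed.

Lemma poly_map_homogeneous k f : homogeneous_polynomial k f -> poly_map f.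
Proof.
move=> [c fE]; pose Q (a : {ffun 'I_m.+1 -> 'I_k.+1}) := (\sum_i a i == k)%N.
have -> : f = \sum_(a | Q a) term (fun i => a i) (c a).
  by apply/funext => x; rewrite fE fct_sumE.
by apply: poly_map_sum => a _; constructor.
Qed.

End PolynomialMaps.

(** * Construction of the Appell sequence by recursion *)

Theorem theorem1 (R : realType) (m k : nat) (hm : (1 <= m)%N)
    (P : 'rV[R]_m.+1 -> clifford R m)
    (hP : homogeneous_polynomial k P) (mP : monogenic setT P) :
  exists M : nat -> 'rV[R]_m.+1 -> clifford R m,
    shifted_appell M /\ M 0%N = P.
Proof.
pose T := {f : 'rV[R]_m.+1 -> clifford R m | poly_map f /\ monogenic setT f}.
(* A choice function for one step of the recursion; it takes the index as well, because the factor
   [n] depends on it. *)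
have [next nextP] : exists next : nat * T -> T, forall p x,
    2^-1 *: conj_cauchy_riemann (sval (next p)) x = p.1%:R *: sval p.2 x.
  suff H (p : nat * T) : exists q : T, forall x,
      2^-1 *: conj_cauchy_riemann (sval q) x = p.1%:R *: sval p.2 x.
    by have [F FP] := choice H; exists F.
  case: p => n [f [pf [_ mf]]] /=.
  (* The factor is an element of the algebra, so that the results on left multiples apply; being an
     integer, it is central and [h] stays monogenic. *)
  pose h x := n%:R * f x.
  have ph : poly_map h := poly_map_lmul _ pf.
  have mh : partial ord0 h + Defs.dirac h = 0.
    apply/funext => x; rewrite -[RHS](mulr0 n%:R) -(mf x I) mulrDr.
    rewrite partial_lmul // mulr_sumr; congr (_ + _); apply: eq_bigr => j _.
    by rewrite partial_lmul // !mulr_natl mulrnAr.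
  have [g [pg gh gD]] := monogenic_antiderivative hm ph mh.
  have mg : monogenic setT g.
    split; first exact: poly_map_C1.
    by move=> x _; rewrite /cauchy_riemann gh gD; exact: subrr.
  exists (exist _ g (conj pg mg)) => x /=.
  (* Here [g] has derivative [h] in [x_0] and [D g = - h], so the conjugate operator yields
     [2 h]. *)
  rewrite /conj_cauchy_riemann gh gD [- (- h) x]opprK -mulr2n.
  rewrite -[h x *+ 2](@scaler_nat R) scalerA mulVf ?pnatr_eq0 // scale1r.
  by rewrite /h mulr_natl scaler_nat.
have pP := poly_map_homogeneous hP.
pose M := fix M n : T :=
  if n is n'.+1 then next (n, M n') else exist _ P (conj pP mP).
exists (fun n => sval (M n)); split; last exact: erefl.
split=> [n|[//|n] _ x].
  by have [/poly_map_polynomial ? ?] := svalP (M n).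
exact: nextP (n.+1, M n) x.
Qed.
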